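(* Let $n\ge 2$ and $\mathcal{O}\in\mathcal{C}_{sg}^{(n)}$. Suppose that $\mathcal{O}\stackrel{\mathsf{p}}{\sim}\mathcal{O}'\stackrel{\mathsf{w}}{\sim}\mathcal{O}''$ or $\mathcal{O}\stackrel{\mathsf{w}}{\sim}\mathcal{O}'\stackrel{\mathsf{p}}{\sim}\mathcal{O}''$ with $\mathcal{O}''\in\mathcal{C}_{sp}^{(n)}$, and that the weak equivalence relation is given by a chain in canonical form containing $d$ shift equivalences. Let $0<\nu\le1$. Then there is a constant $\zeta_{n,\nu}$ depending only on $n$ and $\nu$ such that for any $d+1$ Jacobi operators $\mathcal{J}_1,\dots,\mathcal{J}_{d+1}\in\mathbf{J}_{\mathcal{O}}^{\nu}$, $$\|\mathcal{J}_1\mathcal{J}_2\cdots\mathcal{J}_{d+1}\|_2\le\zeta_{n,\nu},\qquad 0\le\zeta_{n,\nu}<1.$$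
   Context: $\imath=\sqrt{-1}$. For $1\le i<j\le n$ and real $\phi,\alpha$, $R(i,j,\phi,\alpha)$ is the $n\times n$ matrix equal to $I_n$ except for entries $(i,i)=(j,j)=\cos\phi$, $(i,j)=-e^{\imath\alpha}\sin\phi$, $(j,i)=e^{-\imath\alpha}\sin\phi$. Let $N=n(n-1)/2$. For $A=(a_{st})\in\mathbb{C}^{n\times n}$ let $c_t=(a_{1t},\dots,a_{t-1,t})^T$, $r_s=(a_{s1},\dots,a_{s,s-1})$ and $\mathrm{ve}(A)=[c_2^T,\dots,c_n^T,r_2,\dots,r_n]^T\in\mathbb{C}^{2N}$. Let $\nu_{ij}$ set entries $(i,j),(j,i)$ of a matrix to zero. The Jacobi annihilator $\mathcal{R}_{ij}(U)$, $U=R(i,j,\phi,\alpha)$, is the $2N\times2N$ matrix with $\mathcal{R}_{ij}(U)\mathrm{ve}(A)=\mathrm{ve}(\nu_{ij}(U^*AU))$ for all $A$; $\mathbf{R}_{ij}^{\nu}=\{\mathcal{R}_{ij}(U):U=R(i,j,\phi,\alpha),|\cos\phi|\ge\nu\}$. Let $\mathcal{P}_n=\{(r,s):1\le r<s\le n\}$; an ordering is a sequence listing each element of $\mathcal{P}_n$ exactly once. For an ordering $\mathcal{O}=(i_0,j_0),\dots,(i_{N-1},j_{N-1})$, $\mathbf{J}_{\mathcal{O}}^{\nu}=\{\mathcal{R}_{i_{N-1}j_{N-1}}\cdots\mathcal{R}_{i_0j_0}:\mathcal{R}_{i_kj_k}\in\mathbf{R}_{i_kj_k}^{\nu}\}$;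 $\|\cdot\|_2$ is the spectral norm. Relations on orderings: an admissible transposition swaps two adjacent pairs $(i_r,j_r),(i_{r+1},j_{r+1})$ with $\{i_r,j_r\}\cap\{i_{r+1},j_{r+1}\}=\emptyset$; $\mathcal{O}\sim\mathcal{O}'$ (equivalent) if one is obtained from the other by finitely many admissible transpositions; $\mathcal{O}\stackrel{\mathsf{s}}{\sim}\mathcal{O}'$ (shift-equivalent) if $\mathcal{O}=[\mathcal{O}_1,\mathcal{O}_2]$ and $\mathcal{O}'=[\mathcal{O}_2,\mathcal{O}_1]$ (concatenation); $\mathcal{O}\stackrel{\mathsf{w}}{\sim}\mathcal{O}'$ (weak equivalent) if there is a chain $\mathcal{O}=\mathcal{O}_0,\mathcal{O}_1,\dots,\mathcal{O}_r=\mathcal{O}'$ of orderings in which each two adjacent terms are equivalent or shift-equivalent; such a chain is in canonical form if the relations between consecutive terms alternate between $\sim$ and $\stackrel{\mathsf{s}}{\sim}$. $\mathcal{O}\stackrel{\mathsf{p}}{\sim}\mathcal{O}'$ (permutation equivalent) if there is a permutation $\mathsf{q}$ of $\{1,\dots,n\}$ such that $\mathcal{O}'$ is obtained by replacing each pair $(i_k,j_k)$ of $\mathcal{O}$ by the pair with entries $\mathsf{q}(i_k),\mathsf{q}(j_k)$ (written in increasing order). $\mathcal{C}_c^{(n)}$ is the set of orderings $(1,2),(\tau_3(1),3),(\tau_3(2),3),\dots,(\tau_n(1),n),\dots,(\tau_n(n-1),n)$, $\tau_j$ a permutation of $\{1,\dots,j-1\}$; $\mathcal{C}_r^{(n)}$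 is the set of orderings $(n-1,n),(n-2,\tau_{n-2}(n-1)),(n-2,\tau_{n-2}(n)),\dots,(1,\tau_1(2)),\dots,(1,\tau_1(n))$, $\tau_i$ a permutation of $\{i+1,\dots,n\}$; with reverses $\overleftarrow{\mathcal{C}}_c^{(n)},\overleftarrow{\mathcal{C}}_r^{(n)}$ (sets of orderings whose reversed sequence lies in $\mathcal{C}_c^{(n)}$, resp. $\mathcal{C}_r^{(n)}$), $\mathcal{C}_{sp}^{(n)}=\mathcal{C}_c^{(n)}\cup\overleftarrow{\mathcal{C}}_c^{(n)}\cup\mathcal{C}_r^{(n)}\cup\overleftarrow{\mathcal{C}}_r^{(n)}$. The class of generalized serial orderings $\mathcal{C}_{sg}^{(n)}$ is the set of orderings $\mathcal{O}$ for which there are orderings $\mathcal{O}'$ and $\mathcal{O}''\in\mathcal{C}_{sp}^{(n)}$ with $\mathcal{O}\stackrel{\mathsf{p}}{\sim}\mathcal{O}'\stackrel{\mathsf{w}}{\sim}\mathcal{O}''$ or $\mathcal{O}\stackrel{\mathsf{w}}{\sim}\mathcal{O}'\stackrel{\mathsf{p}}{\sim}\mathcal{O}''$, the weak equivalence being given in canonical form. *)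

(* Defs.v *)
From HB Require Import structures.
From mathcomp Require Import all_boot all_order all_algebra all_fingroup.
From mathcomp Require Import boolp classical_sets reals trigo.
From mathcomp Require Import complex.
Set Implicit Arguments. Unset Strict Implicit. Unset Printing Implicit Defensive.
Import Order.TTheory GRing.Theory Num.Theory.
Local Open Scope ring_scope.

(* Indices are 0-based: the paper's index k in {1..n} is the ordinal k-1 : 'I_n. *)

Definition NN (n : nat) : nat := ((n * n.-1) %/ 2)%N.

Section Defs.
Variable R : realType.
Local Notation C := R[i].

Definition cexpi (a : R) : C := (cos a +i* sin a)%C.

Definition rot (n : nat) (i j : 'I_n) (phi alpha : R) : 'M[C]_n :=
  \matrix_(k, l)
    if (k == i) && (l == i) then (cos phi)%:C%C
    else if (k == j) && (l == j) then (cos phi)%:C%C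
    else if (k == i) && (l == j) then - (cexpi alpha * (sin phi)%:C%C)
    else if (k == j) && (l == i) then (cexpi (- alpha) * (sin phi)%:C%C)
    else (k == l)%:R.

Definition ctr (n : nat) (A : 'M[C]_n) : 'M[C]_n := (map_mx (@conjc R) A)^T.

(* ve(A) = [c_2^T, ..., c_n^T, r_2, ..., r_n]^T *)
Definition ve_seq (n : nat) (A : 'M[C]_n) : seq C :=
  flatten [seq [seq A s t | s <- filter (fun s : 'I_n => (s < t)%N) (enum 'I_n)] | t <- enum 'I_n] ++
  flatten [seq [seq A s t | t <- filter (fun t : 'I_n => (t < s)%N) (enum 'I_n)] | s <- enum 'I_n].

Definition ve (n : nat) (A : 'M[C]_n) : 'cV[C]_(2 * NN n) :=
  \col_(k < 2 * NN n) nth 0 (ve_seq A) k.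

Definition nuij (n : nat) (i j : 'I_n) (A : 'M[C]_n) : 'M[C]_n :=
  \matrix_(k, l) if ((k == i) && (l == j)) || ((k == j) && (l == i)) then 0 else A k l.

Definition is_annihilator (n : nat) (i j : 'I_n) (U : 'M[C]_n)
    (M : 'M[C]_(2 * NN n)) : Prop :=
  forall A : 'M[C]_n, M *m ve A = ve (nuij i j (ctr U *m A *m U)).

Definition in_Rnu (n : nat) (nu : R) (i j : 'I_n) (M : 'M[C]_(2 * NN n)) : Prop :=
  exists phi alpha : R, nu <= `|cos phi| /\ is_annihilator i j (rot i j phi alpha) M.

Fixpoint in_Jnu (n : nat) (nu : R) (O : seq ('I_n * 'I_n)) (M : 'M[C]_(2 * NN n))
  : Prop :=
  match O with
  | [::] => M = 1%:M
  | p :: O' => exists Rk M', in_Rnu nu p.1 p.2 Rk /\ in_Jnu nu O' M' /\ M = M' *m Rk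
  end.

Definition vnorm2 (m : nat) (x : 'cV[C]_m) : R :=
  \sum_(k < m) ((complex.Re (x k 0)) ^+ 2 + (complex.Im (x k 0)) ^+ 2).

Definition spec_norm (m : nat) (A : 'M[C]_m) : R :=
  sup [set Num.sqrt (vnorm2 (A *m x)) | x in [set x : 'cV[C]_m | vnorm2 x = 1]]%classic.

End Defs.

Definition pair_t (n : nat) := ('I_n * 'I_n)%type.

Definition is_ordering (n : nat) (O : seq (pair_t n)) : Prop :=
  uniq O /\ forall p : pair_t n, (p \in O) = (p.1 < p.2)%N.

Definition disjoint_pairs (n : nat) (p q : pair_t n) : bool :=
  [&& p.1 != q.1, p.1 != q.2, p.2 != q.1 & p.2 != q.2].

Definition adm_transp (n : nat) (O O' : seq (pair_t n)) : Prop :=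
  exists s1 s2 p q, disjoint_pairs p q /\
    O = s1 ++ [:: p; q] ++ s2 /\ O' = s1 ++ [:: q; p] ++ s2.

Inductive ord_equiv (n : nat) : seq (pair_t n) -> seq (pair_t n) -> Prop :=
  | ord_equiv_refl O : ord_equiv O O
  | ord_equiv_step O O' O'' : adm_transp O O' -> ord_equiv O' O'' -> ord_equiv O O''.

Definition shift_equiv (n : nat) (O O' : seq (pair_t n)) : Prop :=
  exists O1 O2, O = O1 ++ O2 /\ O' = O2 ++ O1.

Fixpoint is_wchain (n : nat) (O : seq (pair_t n)) (steps : seq (bool * seq (pair_t n)))
    (Oend : seq (pair_t n)) : Prop :=
  match steps with
  | [::] => O = Oend
  | (b, O1) :: st =>
      (if b then shift_equiv O O1 else ord_equiv O O1) /\ is_wchain O1 st Oend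
  end.

(* weak equivalence given by a chain in canonical form (alternating relations)
   containing exactly d shift equivalences *)
Definition canon_weak_equiv (n : nat) (d : nat) (O O' : seq (pair_t n)) : Prop :=
  exists steps : seq (bool * seq (pair_t n)),
    is_wchain O steps O' /\ sorted (fun a b => a.1 != b.1) steps /\ count fst steps = d.

Definition sortpair (n : nat) (a b : 'I_n) : pair_t n :=
  if (a < b)%N then (a, b) else (b, a).

Definition perm_equiv (n : nat) (O O' : seq (pair_t n)) : Prop :=
  exists q : 'S_n, O' = [seq sortpair (q p.1) (q p.2) | p <- O].

Definition in_Cc (n : nat) (O : seq (pair_t n)) : Prop :=
  exists s : 'I_n -> seq (pair_t n),
    (forall t : 'I_n, perm_eq (s t) [seq (r, t) | r <- filter (fun r : 'I_n => (r < t)%N) (enum 'I_n)]) /\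
    O = flatten [seq s t | t <- enum 'I_n].

Definition in_Cr (n : nat) (O : seq (pair_t n)) : Prop :=
  exists s : 'I_n -> seq (pair_t n),
    (forall r : 'I_n, perm_eq (s r) [seq (r, t) | t <- filter (fun t : 'I_n => (r < t)%N) (enum 'I_n)]) /\
    O = flatten [seq s r | r <- rev (enum 'I_n)].

Definition in_Csp (n : nat) (O : seq (pair_t n)) : Prop :=
  in_Cc O \/ in_Cc (rev O) \/ in_Cr O \/ in_Cr (rev O).

Definition in_Csg (n : nat) (O : seq (pair_t n)) : Prop :=
  is_ordering O /\ exists O' O'' d, in_Csp O'' /\
    ((perm_equiv O O' /\ canon_weak_equiv d O' O'') \/
     (canon_weak_equiv d O O' /\ perm_equiv O' O'')).

(* Main.v *)
(* Vectors of length 2N are off-diagonal matrices with the Frobenius norm, and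
   a Jacobi annihilator removes the energy of the entries (i,j), (j,i) before
   acting isometrically on the rest. For a column-cyclic ordering, suppose the
   total energy L lost in a sweep is small. Going through the columns one by one,
   the leading block stays O(L): each annihilated entry of column t is a product
   of cosines (bounded below by nu) times its initial value, plus a combination
   of entries of the previous leading block, so the initial column is O(L) too.
   Hence the initial energy is at most a constant times L, and a sweep contracts
   the energy by a factor kappa < 1 depending only on n and nu.

   The contraction property passes to the reversed ordering by taking adjoints,
   and to row-cyclic and permuted orderings by relabelling the indices. Steps on
   disjoint pairs commute, and (O1 O2)^(m+1) = O1 (O2 O1)^m O2, so each shift
   equivalence costs one more sweep and d + 1 sweeps of O contain a serial one. *)

Require Import Defs.
From HB Require Import structures.
From mathcomp Require Import all_boot all_order all_algebra all_fingroup.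
From mathcomp Require Import boolp classical_sets reals trigo.
From mathcomp Require Import complex.
From mathcomp Require Import ring lra.
Import Order.TTheory GRing.Theory Num.Theory.
Local Open Scope ring_scope.
Set Implicit Arguments. Unset Strict Implicit. Unset Printing Implicit Defensive.

Local Notation rot := Defs.rot.

(** * Squared moduli and the entries of a plane rotation *)

Definition sqc (R : realType) (x : R[i]) : R :=
  complex.Re x ^+ 2 + complex.Im x ^+ 2.

Lemma sqc_ge0 (R : realType) (x : R[i]) : 0 <= sqc x.
Proof. by rewrite addr_ge0 ?sqr_ge0. Qed.

Lemma sqcM (R : realType) (x y : R[i]) : sqc (x * y) = sqc x * sqc y.
Proof. by case: x => a b; case: y => c d; rewrite /sqc /=; ring. Qed.

Lemma sqc0 (R : realType) : sqc (0 : R[i]) = 0.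
Proof. by rewrite /sqc /= expr0n addr0. Qed.

Lemma sqcN (R : realType) (x : R[i]) : sqc (- x) = sqc x.
Proof. by case: x => a b; rewrite /sqc /= !sqrrN. Qed.

Lemma sqcD (R : realType) (x y : R[i]) : sqc (x + y) <= 2 * (sqc x + sqc y).
Proof.
case: x => a b; case: y => c d; rewrite /sqc /=.
have := sqr_ge0 (a - c); have := sqr_ge0 (b - d); nra.
Qed.

Definition rotc (R : realType) (phi : R) : R[i] := (cos phi)%:C%C.
Definition rots (R : realType) (phi alpha : R) : R[i] :=
  cexpi alpha * (sin phi)%:C%C.

Lemma rotsN (R : realType) (phi alpha : R) :
  rots (- phi) alpha = - rots phi alpha.
Proof. by rewrite /rots sinN raddfN mulrN. Qed.

Lemma rotcN (R : realType) (phi : R) : rotc (- phi) = rotc phi.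
Proof. by rewrite /rotc cosN. Qed.

Lemma rots_conj (R : realType) (phi alpha : R) :
  (rots phi alpha)^*%C = rots phi (- alpha).
Proof.
apply/eqP; rewrite /rots /cexpi /= eq_complex /= sinN cosN; apply/andP; split; apply/eqP; ring.
Qed.

Lemma conjcN (R : realType) (x : R[i]) : conjc (- x) = - conjc x.
Proof. exact: rmorphN. Qed.

Lemma conjcD (R : realType) (x y : R[i]) : conjc (x + y) = conjc x + conjc y.
Proof. exact: rmorphD. Qed.

Lemma conjcM (R : realType) (x y : R[i]) : conjc (x * y) = conjc x * conjc y.
Proof. exact: rmorphM. Qed.

Lemma rotc_conj (R : realType) (phi : R) : (rotc phi)^*%C = rotc phi.
Proof. by rewrite /rotc conjc_real. Qed.

(** Since [rots phi (- alpha)] is the conjugate of [rots phi alpha], this is the Pythagorean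
    identity, solved for the squared cosine so that [ring] can substitute it. *)
Lemma rotcs1 (R : realType) (phi alpha : R) :
  rotc phi * rotc phi = 1 - rots phi alpha * rots phi (- alpha).
Proof.
have := cos2Dsin2 phi; have := cos2Dsin2 alpha => ha hp.
apply/eqP; rewrite /rotc /rots /cexpi eq_complex /= sinN cosN; apply/andP; split; apply/eqP; nra.
Qed.

Lemma sqc_rotc (R : realType) (phi : R) : sqc (rotc phi) = cos phi ^+ 2.
Proof. by rewrite /sqc /= expr0n addr0. Qed.

Lemma sqc_rots (R : realType) (phi alpha : R) :
  sqc (rots phi alpha) = sin phi ^+ 2.
Proof.
rewrite /rots sqcM /sqc /= cos2Dsin2; ring.
Qed.

Lemma sqc_rotc_le1 (R : realType) (phi : R) : sqc (rotc phi) <= 1.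
Proof. by rewrite sqc_rotc cos2sin2 lerBlDr lerDl sqr_ge0. Qed.

Lemma sqc_rots_le1 (R : realType) (phi alpha : R) : sqc (rots phi alpha) <= 1.
Proof. by rewrite sqc_rots sin2cos2 lerBlDr lerDl sqr_ge0. Qed.

(** * Matrix algebra of rotations and of clearing a 2x2 block *)

Section Rotation.
Variables (R : realType) (n : nat).
Implicit Types (i j k l : 'I_n) (A B : 'M[R[i]]_n) (phi alpha : R).

Lemma rotE i j phi alpha k l : i != j ->
  rot i j phi alpha k l =
    if k == i then
      if l == i then rotc phi else if l == j then - rots phi alpha else 0
    else if k == j then
      if l == i then rots phi (- alpha) else if l == j then rotc phi else 0
    else (k == l)%:R.
Proof.
move=> ij; rewrite mxE.
have [->|ki] /= := eqVneq k i; first rewrite (negbTE ij) /=.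
  by case: (eqVneq l i) => [//|li]; case: (eqVneq l j).
have [->|kj] //= := eqVneq k j.
case: (eqVneq l j) => [lj|lj]; case: (eqVneq l i) => // li.
by rewrite -li -lj eqxx in ij.
Qed.

Lemma mulmx_rot A i j phi alpha k l : i != j ->
  (A *m rot i j phi alpha) k l =
    if l == i then A k i * rotc phi + A k j * rots phi (- alpha)
    else if l == j then A k j * rotc phi - A k i * rots phi alpha
    else A k l.
Proof.
move=> ij; have ji : j != i by rewrite eq_sym.
rewrite mxE (bigD1 i) //= (bigD1 j) //= !rotE // eqxx (negbTE ji) eqxx.
rewrite (eq_bigr (fun m => if m == l then A k m else 0)); last first.
  move=> m /andP[mi mj]; rewrite rotE // (negbTE mi) (negbTE mj).
  by case: eqP; rewrite ?mulr1 ?mulr0.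
rewrite -big_mkcondr /=; have [->|li] := eqVneq l i.
  rewrite big1 ?addr0 // => m /andP[/andP[mi _] /eqP mE].
  by rewrite mE eqxx in mi.
have [->|lj] := eqVneq l j.
  rewrite big1 ?addr0 ?mulrN 1?addrC // => m /andP[/andP[_ mj] /eqP mE].
  by rewrite mE eqxx in mj.
rewrite !mulr0 !add0r (big_pred1 l) // => m.
by rewrite /=; have [->|] := eqVneq m l; rewrite ?li ?lj ?andbF.
Qed.

Lemma ctrM A B : ctr (A *m B) = ctr B *m ctr A.
Proof.
apply/matrixP=> k l; rewrite !mxE rmorph_sum; apply: eq_bigr => m _.
by rewrite !mxE rmorphM mulrC.
Qed.

Lemma ctrK : involutive (@ctr R n).
Proof. by move=> A; apply/matrixP=> k l; rewrite !mxE conjcK. Qed.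

Lemma ctr_rot i j phi alpha : i != j ->
  ctr (rot i j phi alpha) = rot i j (- phi) alpha.
Proof.
move=> ij; apply/matrixP=> k l; rewrite [LHS]mxE [LHS]mxE !rotE //.
case: (eqVneq l i) => li; case: (eqVneq k i) => ki;
  case: (eqVneq l j) => lj; case: (eqVneq k j) => kj;
  try (by subst; rewrite eqxx in ij);
  rewrite ?conjc0 ?rotc_conj ?rotcN ?conjcN ?rots_conj ?rotsN ?opprK //.
all: rewrite ?conjc_nat ?[k == l]eq_sym //.
- by rewrite li eq_sym (negbTE ki).
- by rewrite ki (negbTE li).
- by rewrite lj eq_sym (negbTE kj).
- by rewrite kj (negbTE lj).
Qed.

Lemma mul_ctr_rotmx A i j phi alpha k l : i != j ->
  (ctr (rot i j phi alpha) *m A) k l =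
    if k == i then A i l * rotc phi + A j l * rots phi alpha
    else if k == j then A j l * rotc phi - A i l * rots phi (- alpha)
    else A k l.
Proof.
(* The row formula is the column formula [mulmx_rot] for [ctr A], conjugated back. *)
move=> ij; rewrite -{1}(ctrK A) -ctrM mxE mxE mulmx_rot //.
by case: ifP => _; [|case: ifP => _];
  rewrite ?conjcD ?conjcN ?(conjcM _ (rotc _)) ?(conjcM _ (rots _ _)) !mxE ?conjcK ?rots_conj ?rotc_conj ?opprK.
Qed.

Lemma mulmx_rotVK A i j phi alpha : i != j ->
  A *m rot i j phi alpha *m rot i j (- phi) alpha = A.
Proof.
move=> ij; have ji : j != i by rewrite eq_sym.
have h := rotcs1 phi alpha.
apply/matrixP=> k l; rewrite mulmx_rot //.
have [->|li] := eqVneq l i.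
  rewrite !mulmx_rot // eqxx (negbTE ji) eqxx rotcN rotsN.
  move: (rotc phi) (rots phi alpha) (rots phi (- alpha)) h => c s s' h; ring: h.
have [->|lj] := eqVneq l j; last by rewrite mulmx_rot // (negbTE li) (negbTE lj).
rewrite !mulmx_rot // eqxx (negbTE ji) eqxx rotcN rotsN.
move: (rotc phi) (rots phi alpha) (rots phi (- alpha)) h => c s s' h; ring: h.
Qed.

Lemma rot_unitary i j phi alpha : i != j ->
  rot i j phi alpha *m ctr (rot i j phi alpha) = 1%:M.
Proof. by move=> ij; rewrite ctr_rot // -{1}[rot _ _ _ _]mul1mx mulmx_rotVK. Qed.

(** Exchanging the two indices exchanges the two sine entries, up to sign and conjugation; negating
    both angles compensates for this. *)
Lemma rotC i j phi alpha : i != j ->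
  rot j i (- phi) (- alpha) = rot i j phi alpha.
Proof.
move=> ij; have ji : j != i by rewrite eq_sym.
apply/matrixP=> k l; rewrite !rotE // rotcN !rotsN !opprK.
by case: (eqVneq l i) => li; case: (eqVneq k i) => ki;
  case: (eqVneq l j) => lj; case: (eqVneq k j) => kj //;
  subst; rewrite eqxx in ij.
Qed.

Lemma mulmx_rotC A i j k l phi alpha psi beta :
  i != j -> k != l -> disjoint_pairs (i, j) (k, l) ->
  A *m rot i j phi alpha *m rot k l psi beta =
  A *m rot k l psi beta *m rot i j phi alpha.
Proof.
move=> ij kl /and4P[/= ik il jk jl].
have [ki li kj lj] : [/\ k != i, l != i, k != j & l != j].
  by split; rewrite eq_sym.
apply/matrixP=> u v; rewrite !mulmx_rot //.
rewrite !(negbTE ik) !(negbTE il) !(negbTE jk) !(negbTE jl).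
rewrite !(negbTE ki) !(negbTE li) !(negbTE kj) !(negbTE lj).
have [->|//] := eqVneq v k; first by rewrite (negbTE ki) (negbTE kj).
have [->|//] := eqVneq v l; by rewrite (negbTE li) (negbTE lj).
Qed.

Definition block0 (p : pair_t n) A : 'M[R[i]]_n :=
  \matrix_(k, l) if ((k == p.1) || (k == p.2)) && ((l == p.1) || (l == p.2))
                 then 0 else A k l.

(** The rotation mixes [i] and [j] only with each other, so conjugation preserves both the 2x2 block
    and its complement. *)
Lemma block0_conj i j phi alpha A : i != j ->
  block0 (i, j) (ctr (rot i j phi alpha) *m A *m rot i j phi alpha) =
  ctr (rot i j phi alpha) *m block0 (i, j) A *m rot i j phi alpha.
Proof.
move=> ij; have ji : j != i by rewrite eq_sym.
apply/matrixP=> k l; rewrite mulmx_rot // [LHS]mxE mulmx_rot // !mul_ctr_rotmx //.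
rewrite !mxE /= !eqxx !orbT /=.
by case: (eqVneq l i) => li; case: (eqVneq k i) => ki;
  case: (eqVneq l j) => lj; case: (eqVneq k j) => kj;
  rewrite ?andbT ?andbF ?mul0r ?subr0 ?addr0 ?mul0r ?subr0 ?addr0.
Qed.

Lemma block0_mulr p q phi alpha A :
  q.1 != q.2 -> disjoint_pairs p q ->
  block0 p (A *m rot q.1 q.2 phi alpha) = block0 p A *m rot q.1 q.2 phi alpha.
Proof.
case: p q => [i j] [k l] /= kl /and4P[/= ik il jk jl].
have [ki li kj lj] : [/\ k != i, l != i, k != j & l != j].
  by split; rewrite eq_sym.
apply/matrixP=> u v; rewrite mulmx_rot // [LHS]mxE mulmx_rot // !mxE /=.
rewrite !(negbTE ki) !(negbTE li) !(negbTE kj) !(negbTE lj) !andbF.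
have [->|vk] := eqVneq v k; first by rewrite (negbTE ki) (negbTE kj) andbF.
have [->|vl] := eqVneq v l; first by rewrite (negbTE li) (negbTE lj) andbF.
by [].
Qed.

Lemma block0_ctr p A : block0 p (ctr A) = ctr (block0 p A).
Proof.
apply/matrixP=> u v; rewrite !mxE andbC.
by case: ifP; rewrite ?conjc0.
Qed.

Lemma block0_mull p q phi alpha A :
  q.1 != q.2 -> disjoint_pairs p q ->
  block0 p (ctr (rot q.1 q.2 phi alpha) *m A) =
  ctr (rot q.1 q.2 phi alpha) *m block0 p A.
Proof.
move=> hq hpq; apply: (can_inj ctrK).
by rewrite -block0_ctr !ctrM !ctrK block0_mulr // block0_ctr.
Qed.

Lemma block0C p q A : block0 p (block0 q A) = block0 q (block0 p A).
Proof. by apply/matrixP=> u v; rewrite !mxE; do 2!case: ifP. Qed.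

End Rotation.

(** * The Frobenius inner product and the energy *)

Section Energy.
Variables (R : realType) (n : nat).
Implicit Types (i j k l : 'I_n) (A B U : 'M[R[i]]_n).

Definition energy A : R := \sum_(p : 'I_n * 'I_n) sqc (A p.1 p.2).

(** The real part makes matrices a real Euclidean space, so that inequalities take place in [R]. *)
Definition inner A B : R := complex.Re (\tr (ctr A *m B)).

Lemma innerE A B :
  inner A B = \sum_(p : 'I_n * 'I_n) complex.Re (conjc (A p.1 p.2) * B p.1 p.2).
Proof.
rewrite /inner /mxtrace.
have ReS (I : finType) (F : I -> R[i]) :
    complex.Re (\sum_x F x) = \sum_x complex.Re (F x).
  by apply: big_morph => // -[? ?] [].
rewrite -(pair_bigA _ (fun k l => complex.Re (conjc (A k l) * B k l))) exchange_big /=.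
rewrite ReS; apply: eq_bigr => k _; rewrite mxE ReS.
by apply: eq_bigr => l _; rewrite !mxE.
Qed.

Lemma innerC A B : inner A B = inner B A.
Proof.
rewrite !innerE; apply: eq_bigr => p _.
case: (A _ _) => a b; case: (B _ _) => c d /=; ring.
Qed.

Lemma energyE A : energy A = inner A A.
Proof.
rewrite innerE; apply: eq_bigr => p _; case: (A _ _) => a b; rewrite /sqc /=; ring.
Qed.

Lemma inner_conj U A B :
  inner (ctr U *m A *m U) B = inner A (U *m B *m ctr U).
Proof.
by rewrite /inner !ctrM ctrK -!mulmxA mxtrace_mulC -!mulmxA.
Qed.

Lemma energy_conj U A : U *m ctr U = 1%:M -> energy (ctr U *m A *m U) = energy A.
Proof.
by move=> UU; rewrite !energyE inner_conj !mulmxA UU mul1mx -mulmxA UU mulmx1.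
Qed.

(** Entrywise, this expands |a - q b|^2 >= 0. *)
Lemma inner_amgm (q : R) A B :
  2 * q * inner A B <= energy A + q ^+ 2 * energy B.
Proof.
rewrite innerE /energy !mulr_sumr -big_split /=; apply: ler_sum => p _.
case: (A _ _) => a b; case: (B _ _) => c d; rewrite /sqc /=.
have := sqr_ge0 (a - q * c); have := sqr_ge0 (b - q * d); nra.
Qed.

Lemma inner_block0 p A B : inner (block0 p A) B = inner A (block0 p B).
Proof.
rewrite !innerE; apply: eq_bigr => x _; rewrite !mxE.
by case: ifP => // _; rewrite conjc0 mul0r mulr0.
Qed.

Lemma energy_block0 (p x : pair_t n) A :
  (x.1 == p.1) || (x.1 == p.2) -> (x.2 == p.1) || (x.2 == p.2) ->
  energy (block0 p A) + sqc (A x.1 x.2) <= energy A.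
Proof.
move=> x1 x2; rewrite /energy (bigD1 x) //= [leRHS](bigD1 x) //= mxE x1 x2 /= sqc0.
rewrite add0r addrC lerD2r; apply: ler_sum => y _; rewrite mxE.
by case: ifP; rewrite ?sqc0 ?sqc_ge0.
Qed.

Definition zdiag A : Prop := forall k, A k k = 0.

End Energy.

(** * Words of annihilation steps and their adjoints *)

Definition letter (R : realType) (n : nat) := (pair_t n * (R * R))%type.

Section Words.
Variables (R : realType) (n : nat).
Implicit Types (i j k l : 'I_n) (A B : 'M[R[i]]_n).
Implicit Types (x y : letter R n) (w : seq (letter R n)) (O : seq (pair_t n)).

Definition lrot x : 'M[R[i]]_n := rot x.1.1 x.1.2 x.2.1 x.2.2.

(* On matrices with zero diagonal this is the off-diagonal part of
   [nuij (U^* A U)], but annihilating the whole 2x2 block before conjugating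
   makes it visibly a projection followed by a unitary map. *)
Definition step x A : 'M[R[i]]_n := ctr (lrot x) *m block0 x.1 A *m lrot x.

(** The first letter acts first, whereas in a product of operators it is the rightmost factor. *)
Definition run A w : 'M[R[i]]_n := foldl (fun B x => step x B) A w.

Definition proper x := x.1.1 != x.1.2.

Lemma stepE x A : proper x ->
  step x A = block0 x.1 (ctr (lrot x) *m A *m lrot x).
Proof. by case: x => [[i j] [phi alpha]] ij; rewrite block0_conj. Qed.

Lemma step_block0 x A k l : proper x ->
  (k == x.1.1) || (k == x.1.2) -> (l == x.1.1) || (l == x.1.2) ->
  step x A k l = 0.
Proof. by move=> px kx lx; rewrite stepE // mxE kx lx. Qed.

Definition off_pair (p : pair_t n) k := (k != p.1) && (k != p.2).

Lemma step_other x A k l : proper x -> off_pair x.1 k -> off_pair x.1 l ->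
  step x A k l = A k l.
Proof.
move=> px /andP[k1 k2] /andP[l1 l2]; rewrite /step /lrot.
rewrite mulmx_rot // (negbTE l1) (negbTE l2) mul_ctr_rotmx //.
by rewrite (negbTE k1) (negbTE k2) mxE (negbTE k1) (negbTE k2).
Qed.

Lemma step_col1 x A k : proper x -> off_pair x.1 k ->
  step x A k x.1.1 = A k x.1.1 * rotc x.2.1 + A k x.1.2 * rots x.2.1 (- x.2.2).
Proof.
move=> px /andP[k1 k2]; rewrite /step /lrot mulmx_rot // eqxx.
by rewrite !mul_ctr_rotmx // !mxE (negbTE k1) (negbTE k2).
Qed.

Lemma step_col2 x A k : proper x -> off_pair x.1 k ->
  step x A k x.1.2 = A k x.1.2 * rotc x.2.1 - A k x.1.1 * rots x.2.1 x.2.2.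
Proof.
move=> px /andP[k1 k2]; rewrite /step /lrot mulmx_rot // eqxx eq_sym (negbTE px).
by rewrite !mul_ctr_rotmx // !mxE (negbTE k1) (negbTE k2).
Qed.

Lemma step_row1 x A l : proper x -> off_pair x.1 l ->
  step x A x.1.1 l = A x.1.1 l * rotc x.2.1 + A x.1.2 l * rots x.2.1 x.2.2.
Proof.
move=> px /andP[l1 l2]; rewrite /step /lrot mulmx_rot // (negbTE l1) (negbTE l2).
by rewrite mul_ctr_rotmx // eqxx !mxE (negbTE l1) (negbTE l2) !andbF.
Qed.

Lemma step_row2 x A l : proper x -> off_pair x.1 l ->
  step x A x.1.2 l = A x.1.2 l * rotc x.2.1 - A x.1.1 l * rots x.2.1 (- x.2.2).
Proof.
move=> px /andP[l1 l2]; rewrite /step /lrot mulmx_rot // (negbTE l1) (negbTE l2).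
rewrite mul_ctr_rotmx // [_ == x.1.1]eq_sym (negbTE px) eqxx.
by rewrite !mxE (negbTE l1) (negbTE l2) !andbF.
Qed.

Lemma zdiag_step x A : proper x -> zdiag A -> zdiag (step x A).
Proof.
move=> px zA k; case kx : ((k == x.1.1) || (k == x.1.2)).
  by rewrite step_block0.
by move/negbT: kx; rewrite negb_or => kx; rewrite step_other.
Qed.

Lemma zdiag_run A w : all proper w -> zdiag A -> zdiag (run A w).
Proof. by elim: w A => //= x w IH A /andP[px /IH pw] /(zdiag_step px) /pw. Qed.

Lemma energy_step x A : proper x -> energy (step x A) = energy (block0 x.1 A).
Proof. by move=> px; rewrite energy_conj // rot_unitary. Qed.

Lemma energy_step_le x A : proper x -> energy (step x A) <= energy A.
Proof.
move=> px; rewrite energy_step //.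
have := @energy_block0 R n x.1 (x.1.1, x.1.1) A; rewrite /= eqxx => /(_ isT isT).
by apply: le_trans; rewrite lerDl sqc_ge0.
Qed.

Lemma energy_run_le A w : all proper w -> energy (run A w) <= energy A.
Proof.
elim: w A => //= x w IH A /andP[px /IH pw].
exact: le_trans (pw _) (energy_step_le A px).
Qed.

Definition ladj x : letter R n := (x.1, (- x.2.1, x.2.2)).

Lemma lrot_ladj x : proper x -> lrot (ladj x) = ctr (lrot x).
Proof. by move=> px; rewrite [in RHS]/lrot ctr_rot. Qed.

(** The adjoint of projecting and then conjugating is conjugating by the inverse and then
    projecting. By [stepE] the two orders agree, so the adjoint is again a step, with [phi]
    negated. *)
Lemma inner_step x A B : proper x ->
  inner (step x A) B = inner A (step (ladj x) B).
Proof.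
move=> px; rewrite (@stepE (ladj x) B px) (lrot_ladj px) ctrK.
by rewrite -inner_block0 -inner_conj.
Qed.

Lemma inner_run A B w : all proper w ->
  inner (run A w) B = inner A (run B (rev (map ladj w))).
Proof.
elim: w A => //= x w IH A /andP[px pw].
by rewrite IH // inner_step // rev_cons /run -cats1 foldl_cat.
Qed.

Lemma step_comm x y A : proper x -> proper y -> disjoint_pairs x.1 y.1 ->
  step x (step y A) = step y (step x A).
Proof.
move=> px py dxy.
have dyx : disjoint_pairs y.1 x.1.
  by move/and4P: dxy => [h1 h2 h3 h4]; apply/and4P; split; rewrite eq_sym.
rewrite /step block0_mulr // block0_mull // block0_mulr // block0_mull // block0C.
have rC (B : 'M[R[i]]_n) : B *m lrot x *m lrot y = B *m lrot y *m lrot x.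
  by apply: mulmx_rotC => //; rewrite -!surjective_pairing.
have rC1 : lrot x *m lrot y = lrot y *m lrot x by have := rC 1%:M; rewrite !mul1mx.
by rewrite !mulmxA -!ctrM rC1 -!mulmxA rC1.
Qed.

End Words.

(** * Contraction along orderings: extension, reversal, exchanges and shifts *)

Section Contraction.
Variables (R : realType) (n : nat) (nu : R).
Implicit Types (A B : 'M[R[i]]_n) (x : letter R n) (w : seq (letter R n)).
Implicit Types (O : seq (pair_t n)) (kappa : R).

Definition admissible x := proper x && (nu <= `|cos x.2.1|).

Lemma admissible_proper w : all admissible w -> all (@proper R n) w.
Proof. by apply: sub_all => x /andP[]. Qed.

(** Energy is a squared norm, so [kappa] bounds the square of an operator norm, uniformly in the
    admissible angles. *)
Definition contracts kappa O : Prop := forall A w,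
  map fst w = O -> all admissible w -> zdiag A ->
  energy (run A w) <= kappa * energy A.

Lemma map_catP (T1 T2 : Type) (f : T1 -> T2) (s : seq T1) s1 s2 :
  map f s = s1 ++ s2 ->
  exists t1 t2, [/\ s = t1 ++ t2, map f t1 = s1 & map f t2 = s2].
Proof.
move=> fs; exists (take (size s1) s), (drop (size s1) s).
by rewrite cat_take_drop map_take map_drop fs take_size_cat // drop_size_cat.
Qed.

Lemma contracts_catr kappa O O' : contracts kappa O -> contracts kappa (O ++ O').
Proof.
move=> cO A w /map_catP[w1 [w2 [-> h1 h2]]]; rewrite all_cat => /andP[a1 a2] zA.
rewrite /run foldl_cat; apply: le_trans (cO A w1 h1 a1 zA).
exact/energy_run_le/admissible_proper.
Qed.

Lemma contracts_catl kappa O O' :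
  0 <= kappa -> contracts kappa O -> contracts kappa (O' ++ O).
Proof.
move=> k0 cO A w /map_catP[w1 [w2 [-> h1 h2]]]; rewrite all_cat => /andP[a1 a2] zA.
have p1 := admissible_proper a1.
rewrite /run foldl_cat; apply: (le_trans (cO _ w2 h2 a2 (zdiag_run p1 zA))).
by rewrite ler_wpM2l // energy_run_le.
Qed.

(** An operator and its adjoint have the same norm, and the adjoint of a sweep runs through the
    reversed ordering. *)
Lemma contracts_rev kappa O : 0 < kappa -> contracts kappa (rev O) -> contracts kappa O.
Proof.
move=> k0 cO A w hw aw zA; have pw := admissible_proper aw.
set B := run A w; pose w' := rev (map (@ladj R n) w).
have cB : energy (run B w') <= kappa * energy B.
  apply: cO; last exact: zdiag_run.
    by rewrite map_rev -map_comp -hw.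
  rewrite all_rev all_map; apply: sub_all aw => x.
  by rewrite /admissible /proper /= cosN.
have eB : energy B = inner (run B w') A.
  by rewrite energyE {1}/B inner_run // innerC.
(* This gives 2 kappa |B|^2 <= |run B w'|^2 + kappa^2 |A|^2 <= kappa |B|^2 + kappa^2 |A|^2, from
   which one factor kappa cancels. *)
have := inner_amgm kappa (run B w') A; rewrite -eB => h.
rewrite -(ler_pM2l k0); nra.
Qed.

Definition opow m O := flatten (nseq m O).

Lemma opowSr m O : opow m.+1 O = opow m O ++ O.
Proof. by rewrite /opow; elim: m => [|m IH] /=; rewrite ?cats0 // -catA -IH. Qed.

Lemma contracts_adm kappa O O' :
  adm_transp O O' -> contracts kappa O' -> contracts kappa O.
Proof.
move=> [s1 [s2 [p [q [dpq [-> ->]]]]]] cO A w /map_catP[w1 [w2 [-> h1 h2]]].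
case: w2 h2 => [|x [|y w2]] //= [xp yq h2].
rewrite all_cat /= => /and4P[a1 ax ay a2] zA.
have := cO A (w1 ++ [:: y, x & w2]).
rewrite map_cat /= h1 xp yq h2 all_cat /= a1 ax ay a2 => /(_ erefl isT zA).
rewrite /run !foldl_cat /= (step_comm _ (proj1 (andP ax)) (proj1 (andP ay))) //.
by rewrite xp yq.
Qed.

Lemma ord_equiv_catl O1 O O' : ord_equiv O O' -> ord_equiv (O1 ++ O) (O1 ++ O').
Proof.
elim=> [?|P P' P'' [s1 [s2 [p [q [d [-> ->]]]]]] _]; first by constructor.
by apply: ord_equiv_step; exists (O1 ++ s1), s2, p, q; rewrite !catA.
Qed.

Lemma ord_equiv_catr O1 O O' : ord_equiv O O' -> ord_equiv (O ++ O1) (O' ++ O1).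
Proof.
elim=> [?|P P' P'' [s1 [s2 [p [q [d [-> ->]]]]]] _]; first by constructor.
by apply: ord_equiv_step; exists s1, (s2 ++ O1), p, q; rewrite -!catA.
Qed.

Lemma contracts_equiv kappa O O' :
  ord_equiv O O' -> contracts kappa O' -> contracts kappa O.
Proof. by elim=> // P P' P'' /contracts_adm h _ IH /IH /h. Qed.

Lemma contracts_opow_equiv kappa m O O' : ord_equiv O O' ->
  contracts kappa (opow m O') -> contracts kappa (opow m O).
Proof.
move=> e.
(* Copies are replaced one at a time; the prefix [O1] collects those already replaced. *)
suff h O1 : contracts kappa (O1 ++ opow m O') -> contracts kappa (O1 ++ opow m O).
  exact: (h [::]).
elim: m O1 => //= m IH O1.
rewrite /opow /= -!/(opow m _) => h.
rewrite catA; apply: IH; rewrite -catA.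
by apply: contracts_equiv h; apply/ord_equiv_catl/ord_equiv_catr.
Qed.

Lemma opow_shift m O1 O2 : opow m.+1 (O1 ++ O2) = O1 ++ opow m (O2 ++ O1) ++ O2.
Proof. by rewrite /opow; elim: m => [|m /= IH]; rewrite /= ?cats0 // IH -!catA. Qed.

(** An equivalence keeps the number of copies. For a shift, [opow_shift] finds the copies of the
    next ordering inside one more copy of the current one, and the pieces at both ends cannot raise
    the energy. *)
Lemma contracts_chain kappa steps m O O' : 0 <= kappa -> is_wchain O steps O' ->
  contracts kappa (opow m O') -> contracts kappa (opow (m + count fst steps) O).
Proof.
move=> k0; elim: steps O => [|[b O1] st IH] O /=; first by rewrite addn0 => ->.
case=> hb /IH h /h; case: b hb => /= [[P [Q [-> ->]]]|e].
  by rewrite addnA addn1 addSn opow_shift => c; apply/contracts_catl/contracts_catr.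
by rewrite add0n; apply: contracts_opow_equiv.
Qed.

End Contraction.

(** * Invariance under permutations of the indices *)

Section Relabelling.
Variables (R : realType) (n : nat) (nu : R).
Implicit Types (A B : 'M[R[i]]_n) (x : letter R n) (w : seq (letter R n)).
Implicit Types (O : seq (pair_t n)) (q : 'S_n).

(** This is conjugation by a permutation matrix. *)
Definition relabel q A : 'M[R[i]]_n := \matrix_(k, l) A (q k) (q l).

Definition qpair q (p : pair_t n) : pair_t n := sortpair (q p.1) (q p.2).

(* Sorting the relabelled pair exchanges the two indices, which amounts to
   changing the signs of both angles. *)
Definition qletter q x : letter R n :=
  (qpair q x.1,
   if (q x.1.1 < q x.1.2)%N then x.2 else (- x.2.1, - x.2.2)).

Lemma relabelM q A B : relabel q (A *m B) = relabel q A *m relabel q B.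
Proof.
apply/matrixP=> k l; rewrite !mxE (reindex_inj (@perm_inj _ q)).
by apply: eq_bigr => m _; rewrite !mxE.
Qed.

Lemma relabel_ctr q A : relabel q (ctr A) = ctr (relabel q A).
Proof. by apply/matrixP=> k l; rewrite !mxE. Qed.

Lemma relabel_qrot q x : proper x -> relabel q (lrot (qletter q x)) = lrot x.
Proof.
case: x => [[i j] [phi alpha]]; rewrite /proper /lrot /qletter /qpair /sortpair /= => ij.
have qij : q i != q j by rewrite (inj_eq perm_inj).
have -> : rot (if (q i < q j)%N then (q i, q j) else (q j, q i)).1
   (if (q i < q j)%N then (q i, q j) else (q j, q i)).2
   (if (q i < q j)%N then (phi, alpha) else (- phi, - alpha)).1
   (if (q i < q j)%N then (phi, alpha) else (- phi, - alpha)).2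
   = rot (q i) (q j) phi alpha by case: ifP => //= _; rewrite rotC.
by apply/matrixP=> k l; rewrite mxE !rotE // !(inj_eq perm_inj).
Qed.

Lemma relabel_block0 q (p : pair_t n) A :
  relabel q (block0 (qpair q p) A) = block0 p (relabel q A).
Proof.
apply/matrixP=> k l; rewrite !mxE /qpair /sortpair.
case: (q p.1 < q p.2)%N; rewrite /= !(inj_eq perm_inj) //.
by rewrite [X in X && _]orbC [X in _ && X]orbC.
Qed.

Lemma relabel_step q x A : proper x ->
  relabel q (step (qletter q x) A) = step x (relabel q A).
Proof.
by move=> px; rewrite /step !relabelM relabel_ctr relabel_qrot // relabel_block0.
Qed.

Lemma relabel_run q w A : all (@proper R n) w ->
  relabel q (run A (map (qletter q) w)) = run (relabel q A) w.
Proof.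
by elim: w A => //= x w IH A /andP[px pw]; rewrite IH // relabel_step.
Qed.

Lemma energy_relabel q A : energy (relabel q A) = energy A.
Proof.
rewrite /energy -(pair_bigA _ (fun k l => sqc (relabel q A k l))) /=.
rewrite -(pair_bigA _ (fun k l => sqc (A k l))) /=.
rewrite [RHS](reindex_inj (@perm_inj _ q)); apply: eq_bigr => k _ /=.
rewrite [RHS](reindex_inj (@perm_inj _ q)); apply: eq_bigr => l _ /=.
by rewrite mxE.
Qed.

Lemma relabelK q A : relabel q (relabel q^-1%g A) = A.
Proof. by apply/matrixP=> k l; rewrite !mxE !permK. Qed.

Lemma contracts_perm kappa O q :
  contracts nu kappa (map (qpair q) O) -> contracts nu kappa O.
Proof.
move=> cO A w hw aw zA; have pw := admissible_proper aw.
(* With [A] written as a relabelled matrix, running [w] becomes relabelling the run of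
   [map (qletter q) w], a word over [map (qpair q) O]. *)
rewrite -(relabelK q A) -relabel_run // !energy_relabel.
have -> : energy A = energy (relabel q^-1%g A) by rewrite energy_relabel.
apply: cO; last by move=> k; rewrite mxE.
  by rewrite -hw -!map_comp.
rewrite all_map; apply: sub_all aw => x /andP[px cx]; apply/andP; split.
  rewrite /= /proper /qletter /qpair /sortpair /=.
  by case: ifP => _ /=; rewrite (inj_eq perm_inj) // eq_sym.
by rewrite /qletter /=; case: ifP => _ //=; rewrite cosN.
Qed.

Lemma contracts_opow_perm kappa m O O' :
  perm_equiv O O' -> contracts nu kappa (opow m O') -> contracts nu kappa (opow m O).
Proof.
move=> [q ->] c; apply: (@contracts_perm _ _ q).
by rewrite /opow map_flatten map_nseq.
Qed.

End Relabelling.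

(** * Row-cyclic orderings as relabelled column-cyclic ones *)

Section RowToColumn.
Variable n : nat.
Implicit Types (O : seq (pair_t n)) (i j k l r t : 'I_n).

Lemma rev_enum_ord : rev (enum 'I_n) = map (@rev_ord n) (enum 'I_n).
Proof.
apply: (inj_map val_inj); rewrite map_rev val_enum_ord -map_comp.
apply: (@eq_from_nth _ 0%N); first by rewrite size_rev size_iota size_map size_enum_ord.
move=> m; rewrite size_rev size_iota => mn.
rewrite nth_rev ?size_iota // nth_iota ?add0n; last by rewrite ltn_subrL (leq_ltn_trans _ mn).
by rewrite (nth_map (Ordinal mn)) ?size_enum_ord //= nth_enum_ord.
Qed.

(** Index reversal sends (r, c) to (rev c, rev r): the block of row r becomes that of column rev r,
    and rows taken from last to first become columns taken from first to last. *)
Lemma in_Cr_flip O : in_Cr O -> exists O', in_Cc O' /\ perm_equiv O O'.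
Proof.
move=> [s [hs ->]]; pose q := perm (@rev_ord_inj n).
pose f := fun p : pair_t n => sortpair (q p.1) (q p.2).
exists (map f (flatten [seq s r | r <- rev (enum 'I_n)])); split; last by exists q.
exists (fun t => map f (s (rev_ord t))); split; last first.
  by rewrite rev_enum_ord map_flatten -!map_comp.
move=> t; have := perm_map f (hs (rev_ord t)); move/perm_trans; apply.
have flt (c : 'I_n) : (rev_ord c < t)%N = (rev_ord t < c)%N.
  by rewrite /= ltn_subLR ?ltn_subLR // !addSn addnC.
have fE (c : 'I_n) : (rev_ord t < c)%N -> f (rev_ord t, c) = (rev_ord c, t).
  by rewrite -flt /f /sortpair /= !permE rev_ordK => /ltnW; rewrite ltnNge => ->.
have -> : [seq f p | p <- [seq (rev_ord t, c) | c : 'I_n <- enum 'I_n & (rev_ord t < c)%N]] =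
    [seq (r, t) | r <- map (@rev_ord n) [seq c : 'I_n <- enum 'I_n | (rev_ord t < c)%N]].
  rewrite -!map_comp; apply/eq_in_map => c; rewrite mem_filter => /andP[hc _].
  exact: fE.
apply: perm_map; apply: uniq_perm.
- by rewrite (map_inj_uniq (@rev_ord_inj n)); apply/filter_uniq/enum_uniq.
- exact/filter_uniq/enum_uniq.
move=> c; rewrite -{1}[c]rev_ordK (mem_map (@rev_ord_inj n)) !mem_filter.
by rewrite -flt rev_ordK -!enumT !mem_enum.
Qed.

End RowToColumn.

(** * Column-cyclic sweeps: small losses force small energy *)

Section ColumnOrderings.
Variables (R : realType) (n : nat) (nu : R).
Hypotheses (nu_gt0 : 0 < nu) (nu_le1 : nu <= 1).
Implicit Types (A B : 'M[R[i]]_n) (x : letter R n) (w : seq (letter R n)).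
Implicit Types (i j k l r t : 'I_n) (L b : R).

(** The matrix is updated along the word, so each entry is measured just before its annihilation. *)
Fixpoint losses_le L A w : Prop :=
  if w is x :: w' then
    [/\ sqc (A x.1.1 x.1.2) <= L, sqc (A x.1.2 x.1.1) <= L
      & losses_le L (step x A) w']
  else True.

Lemma losses_le_cat L A w1 w2 :
  losses_le L A (w1 ++ w2) -> losses_le L A w1 /\ losses_le L (run A w1) w2.
Proof. by elim: w1 A => //= x w1 IH A [h1 h2 /IH[]]. Qed.

(** The losses of the steps are nonnegative and add up to the total loss, and each is at least the
    energy of either annihilated entry. *)
Lemma losses_le_energy L A w : all (@proper R n) w ->
  energy A - energy (run A w) <= L -> losses_le L A w.
Proof.
elim: w A => //= x w IH A /andP[px pw] hL.
have hs := energy_step A px.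
have h1 := @energy_block0 R n x.1 x.1 A; rewrite !eqxx orbT in h1.
have h2 := @energy_block0 R n x.1 (x.1.2, x.1.1) A; rewrite /= !eqxx orbT in h2.
have hr := energy_run_le (step x A) pw.
have {}h1 := h1 isT isT; have {}h2 := h2 isT isT.
have p1 := sqc_ge0 (A x.1.1 x.1.2).
split; [lra | lra | apply: IH => //; lra].
Qed.

Definition bounded m b A :=
  forall k l, (k < m)%N -> (l < m)%N -> sqc (A k l) <= b.

(** The factor 4 is the 2 of [sqcD] times two terms of size at most [b]. *)
Lemma sqc_lincomb b (u v c s : R[i]) : sqc u <= b -> sqc v <= b ->
  sqc c <= 1 -> sqc s <= 1 -> sqc (u * c + v * s) <= 4 * b.
Proof.
move=> ub vb c1 s1; apply: (le_trans (sqcD _ _)); rewrite !sqcM.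
have := ler_pM (sqc_ge0 u) (sqc_ge0 c) ub c1.
have := ler_pM (sqc_ge0 v) (sqc_ge0 s) vb s1.
rewrite !mulr1; lra.
Qed.

Lemma sqc_lincombB b (u v c s : R[i]) : sqc u <= b -> sqc v <= b ->
  sqc c <= 1 -> sqc s <= 1 -> sqc (u * c - v * s) <= 4 * b.
Proof. by move=> *; rewrite -mulNr; apply: sqc_lincomb; rewrite ?sqcN. Qed.

Lemma bounded_step m b x A : proper x -> 0 <= b ->
  (x.1.1 < m)%N -> (x.1.2 < m)%N -> bounded m b A -> bounded m (4 * b) (step x A).
Proof.
move=> px b0 x1 x2 bA k l km lm.
have b4 : b <= 4 * b by lra.
have [c1 s1 s1'] := And3 (sqc_rotc_le1 x.2.1) (sqc_rots_le1 x.2.1 x.2.2)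
                         (sqc_rots_le1 x.2.1 (- x.2.2)).
case kx : ((k == x.1.1) || (k == x.1.2)); case lx : ((l == x.1.1) || (l == x.1.2)).
- by rewrite step_block0 // sqc0 mulr_ge0.
- move/negbT: lx; rewrite negb_or => lx.
  case/orP: kx => /eqP ->; rewrite ?step_row1 ?step_row2 //;
  by [apply: sqc_lincomb => //; apply: bA | apply: sqc_lincombB => //; apply: bA].
- move/negbT: kx; rewrite negb_or => kx.
  case/orP: lx => /eqP ->; rewrite ?step_col1 ?step_col2 //;
  by [apply: sqc_lincomb => //; apply: bA | apply: sqc_lincombB => //; apply: bA].
move/negbT: lx; rewrite negb_or => lx; move/negbT: kx; rewrite negb_or => kx.
by rewrite step_other //; apply: le_trans b4; apply: bA.
Qed.

Lemma bounded_run m b w A : all (@proper R n) w -> 0 <= b ->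
  (forall x, x \in w -> (x.1.1 < m)%N /\ (x.1.2 < m)%N) ->
  bounded m b A -> bounded m (4 ^+ size w * b) (run A w).
Proof.
elim: w b A => [|x w IH] b A /=; first by rewrite expr0 mul1r.
move=> /andP[px pw] b0 wm bA; rewrite exprSr -mulrA.
have [x1 x2] := wm x (mem_head _ _).
apply: IH => //; first by rewrite mulr_ge0.
  by move=> y yw; apply: wm; rewrite inE yw orbT.
exact: bounded_step.
Qed.

(** Solves u c = (u c - v s) + v s for u; dividing by the cosine c costs at most [nu ^- 2]. *)
Lemma sqc_solve b b' (phi : R) (u v s : R[i]) : nu <= `|cos phi| ->
  sqc s <= 1 -> sqc v <= b -> sqc (u * rotc phi - v * s) <= b' ->
  sqc u <= 2 * nu ^- 2 * (b + b').
Proof.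
move=> hc s1 vb hb.
have := sqcD (u * rotc phi - v * s) (v * s); rewrite subrK !sqcM sqc_rotc => h.
have := ler_pM (sqc_ge0 v) (sqc_ge0 s) vb s1; rewrite mulr1 => h'.
have nu2 : 0 < nu ^+ 2 by rewrite exprn_gt0.
have c2 : nu ^+ 2 <= cos phi ^+ 2.
  by rewrite -[leRHS]real_normK ?num_real // lerXn2r ?nnegrE // ltW.
have := ler_wpM2l (sqc_ge0 u) c2 => h''.
rewrite mulrAC ler_pdivlMr //; lra.
Qed.

(* While the pairs [(r, t)] are processed for [r] in [rs], the entries indexed
   by rows and columns still waiting in [rs] do not change, so each annihilated
   entry of column [t] is a product of cosines times its initial value plus a
   combination of such entries. *)
Lemma column_bound m : exists2 C : R, 1 <= C &
  forall t (rs : seq 'I_n) w A L b,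
  size rs = m -> uniq rs -> t \notin rs ->
  map fst w = [seq (r, t) | r <- rs] -> all (admissible nu) w ->
  L <= b -> losses_le L A w ->
  (forall k l, k \in rs -> l \in rs -> sqc (A k l) <= b) ->
  forall k, k \in rs -> sqc (A k t) <= C * b /\ sqc (A t k) <= C * b.
Proof.
elim: m => [|m [C C1 IH]].
  by exists 1 => // t [].
have nu1 : 1 <= nu ^- 2.
  by rewrite invf_ge1 ?exprn_gt0 // expr_le1 // ltW.
(* The factor that [sqc_solve] yields from the bounds [b] and [C * b]. *)
exists (2 * nu ^- 2 * (1 + C)); first by nra.
move=> t [//|r rs] w A L b [sz] /= /andP[rrs urs] trs.
case: w => [//|x w] /= [xr hw] /andP[/andP[px cx] aw] Lb [l1 l2 lw] hA k.
have [tr trs'] : t != r /\ t \notin rs by apply/andP; rewrite -negb_or -in_cons.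
have rt : r != t by rewrite eq_sym.
have off k' : k' \in rs -> off_pair x.1 k'.
  move=> krs; rewrite xr /off_pair /=; apply/andP; split.
    by apply: contraNneq rrs => <-.
  by apply: contraNneq trs' => <-.
have b0 : 0 <= b by apply: le_trans Lb; apply: le_trans l1; apply: sqc_ge0.
have CC : 1 <= 2 * nu ^- 2 * (1 + C) by nra.
(* The entries joining [r] and [t] are annihilated by this very step, so they are losses, at most
   [L]. *)
rewrite inE => /orP[/eqP ->|krs].
  have bb : b <= 2 * nu ^- 2 * (1 + C) * b by rewrite ler_peMl.
  by move: l1 l2; rewrite xr /= => l1 l2; split; apply: le_trans bb; apply: le_trans Lb.
have hA' k' l' : k' \in rs -> l' \in rs -> sqc (step x A k' l') <= b.
  move=> kr lr; rewrite step_other ?off //.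
  by apply: hA; rewrite inE ?kr ?lr orbT.
(* Induction bounds the entry after the step. Its value before the step follows from [sqc_solve],
   because the other entry involved has both indices in [r :: rs]. *)
have [] := IH t rs w (step x A) L b sz urs trs' hw aw Lb lw hA' k krs.
have := step_col2 A px (off _ krs); have := step_row2 A px (off _ krs).
rewrite xr /= => -> -> h1 h2.
have krr : k \in r :: rs by rewrite inE krs orbT.
have -> : 2 * nu ^- 2 * (1 + C) * b = 2 * nu ^- 2 * (b + C * b) by ring.
split; [apply: sqc_solve h1 | apply: sqc_solve h2] => //;
  rewrite ?sqc_rots_le1 //; apply: hA => //; exact: mem_head.
Qed.

(** [K] is chosen before [s], [w] and [A], which makes the final constant uniform in the ordering,
    the angles and the matrix. *)
Lemma columns_bound m : (m <= n)%N -> exists2 K : R, 1 <= K &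
  forall (s : 'I_n -> seq (pair_t n)) w A L,
  (forall t, perm_eq (s t) [seq (r, t) | r <- enum 'I_n & (r < t)%N]) ->
  map fst w = flatten [seq s t | t <- take m (enum 'I_n)] ->
  all (admissible nu) w -> 0 <= L -> zdiag A -> losses_le L A w ->
  bounded m (K * L) (run A w).
Proof.
elim: m => [|m IH] mn.
  by exists 1 => // s w A L _ _ _ _ _ _ k l; rewrite ltn0.
have [K K1 {}IH] := IH (ltnW mn); have [C C1 hC] := column_bound m.
(* [C * K] accounts for the enlarged block before column [t] is processed; each of the [m] steps on
   that column costs at most a factor 4. *)
exists (4 ^+ m * (C * K)).
  by rewrite !mulr_ege1 // exprn_ege1 // ler1n.
move=> s w A L hs; pose t := Ordinal mn.
have -> : take m.+1 (enum 'I_n) = rcons (take m (enum 'I_n)) t.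
  rewrite (take_nth t) ?size_enum_ord //; congr rcons.
  by apply: val_inj; rewrite /= nth_enum_ord.
rewrite map_rcons flatten_rcons => /map_catP[w1 [w2 [-> hw1 hw2]]].
rewrite all_cat => /andP[a1 a2] L0 zA /losses_le_cat[l1 l2].
set B := run A w1 in l2; have bB : bounded m (K * L) B by apply: IH hw1 _ _ _ _.
have zB : zdiag B by apply: zdiag_run => //; apply: admissible_proper a1.
pose rs := map fst (s t).
have sE : s t = [seq (r, t) | r <- rs].
  rewrite /rs -map_comp -[LHS]map_id; apply/eq_in_map => p.
  by rewrite (perm_mem (hs t)) => /mapP[r _ ->].
have prs : perm_eq rs [seq r : 'I_n <- enum 'I_n | (r < t)%N].
  by have := perm_map fst (hs t); rewrite -map_comp map_id.
(* With 0-based indices, the rows above column [t] are exactly the indices of the leading block of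
   size [m]. *)
have mrs r : (r \in rs) = (r < m)%N by rewrite (perm_mem prs) mem_filter mem_enum andbT.
have szrs : size rs = m.
  rewrite (perm_size prs) size_filter.
  transitivity (count (fun j : nat => (j < m)%N) (map val (enum 'I_n))).
    by rewrite count_map; apply: eq_count.
  by rewrite val_enum_ord -size_filter (@filter_iota_ltn 0 n m (ltnW mn)) size_iota.
have urs : uniq rs by rewrite (perm_uniq prs) filter_uniq ?enum_uniq.
have trs : t \notin rs by rewrite mrs ltnn.
rewrite sE in hw2.
have LK : L <= K * L by rewrite ler_peMl.
have hB k : (k < m)%N -> sqc (B k t) <= C * (K * L) /\ sqc (B t k) <= C * (K * L).
  rewrite -mrs; apply: (hC t rs w2 B L (K * L)) => // k' l'; rewrite !mrs; exact: bB.
have KL0 : 0 <= K * L by rewrite (le_trans L0).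
(* The enlarged block consists of the old one, the entries just bounded and the zero diagonal entry
   of [t]. *)
have {}hB : bounded m.+1 (C * (K * L)) B.
  move=> k l; rewrite !ltnS (leq_eqVlt k) (leq_eqVlt l) => /orP[/eqP km|km] /orP[/eqP lm|lm].
  - have -> : k = l by apply: val_inj; rewrite /= km lm.
    by rewrite zB sqc0 mulr_ge0 // (le_trans ler01).
  - by have -> : k = t by [apply: val_inj]; case: (hB l lm).
  - by have -> : l = t by [apply: val_inj]; case: (hB k km).
  by apply: (le_trans (bB k l km lm)); rewrite ler_peMl.
rewrite /run foldl_cat -/(run A w1) -/(run _ w2) -/B -!mulrA.
have -> : 4 ^+ m = 4 ^+ size w2 :> R by rewrite -(size_map fst w2) hw2 size_map szrs.
apply: bounded_run => //.
- exact: admissible_proper a2.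
- by rewrite !mulr_ge0 // (le_trans ler01).
move=> x xw; have : x.1 \in map fst w2 by apply: map_f.
rewrite hw2 => /mapP[r]; rewrite mrs => rm -> /=.
by rewrite ltnS (ltnW rm).
Qed.

Lemma contracts_Cc : exists2 kappa : R, 0 < kappa < 1 &
  forall O : seq (pair_t n), in_Cc O -> contracts nu kappa O.
Proof.
have [K K1 hK] := columns_bound (leqnn n).
(* The final energy is at most n^2 K L, so the initial one is at most M L and a fraction 1/M of it
   is lost. The summand 2 gives M >= 2, which keeps [kappa] positive, as [contracts_rev]
   requires. *)
pose M : R := (n * n)%:R * K + 2.
have nn0 : 0 <= (n * n)%:R :> R by [].
have M2 : 2 <= M by rewrite /M; nra.
have M0 : 0 < M by lra.
exists (1 - M^-1).
  have : M^-1 <= 2^-1 by rewrite lef_pV2 // posrE.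
  have : 0 < M^-1 by rewrite invr_gt0.
  lra.
move=> _ [s [hs ->]] A w hw aw zA; have pw := admissible_proper aw.
pose L := energy A - energy (run A w).
have L0 : 0 <= L by rewrite subr_ge0 energy_run_le.
have hl : losses_le L A w by apply: losses_le_energy.
have hB : bounded n (K * L) (run A w).
  by apply: (hK s) => //; rewrite take_oversize ?size_enum_ord.
have eB : energy (run A w) <= (n * n)%:R * (K * L).
  apply: (le_trans (ler_sum _ (fun p _ => hB p.1 p.2 (ltn_ord _) (ltn_ord _)))).
  by rewrite sumr_const card_prod card_ord mulr_natl.
have : energy A <= M * L by rewrite /M; rewrite /L in eB L0 *; nra.
rewrite -ler_pdivrMl // mulrBl mul1r /L; lra.
Qed.

End ColumnOrderings.

(** * Vectors as zero-diagonal matrices, operators as words *)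

Section Vectorization.
Variables (R : realType) (n : nat).
Implicit Types (A B : 'M[R[i]]_n) (O : seq (pair_t n)).

(** Listing positions instead of values separates the enumeration from the matrix, so that it can be
    counted and inverted. *)
Definition ve_pos : seq (pair_t n) :=
  flatten [seq [seq (s, t) | s : 'I_n <- enum 'I_n & (s < t)%N] | t : 'I_n <- enum 'I_n] ++
  flatten [seq [seq (s, t) | t : 'I_n <- enum 'I_n & (t < s)%N] | s : 'I_n <- enum 'I_n].

Lemma ve_seqE A : ve_seq A = [seq A p.1 p.2 | p <- ve_pos].
Proof.
rewrite /ve_seq /ve_pos map_cat !map_flatten -!map_comp.
by congr (flatten _ ++ flatten _); apply: eq_map => t /=; rewrite -map_comp.
Qed.

Lemma perm_ve_pos : perm_eq ve_pos (enum [pred p : pair_t n | p.1 != p.2]).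
Proof.
apply: uniq_perm; last 1 first.
- move=> [k l]; rewrite mem_enum inE mem_cat /=.
  rewrite -val_eqE neq_ltn; congr (_ || _).
    apply/flatten_mapP/idP => [[t _ /mapP[s]]|kl].
      by rewrite mem_filter => /andP[st _] [-> ->].
    exists l; first by rewrite mem_enum.
    by apply/mapP; exists k => //; rewrite mem_filter kl mem_enum.
  apply/flatten_mapP/idP => [[s _ /mapP[t]]|kl].
    by rewrite mem_filter => /andP[st _] [-> ->].
  exists k; first by rewrite mem_enum.
  by apply/mapP; exists l => //; rewrite mem_filter kl mem_enum.
- rewrite cat_uniq; apply/and3P; split.
  + apply: (@allpairs_uniq_dep _ (fun=> 'I_n) _ (fun t s => (s, t))).
    * exact: enum_uniq.
    * by move=> t _; apply/filter_uniq/enum_uniq.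
    * by move=> [a b] [c d] /= _ _ [-> ->].
  + apply/hasPn => _ /flatten_mapP[s _ /mapP[t hs ->]].
    move: hs; rewrite mem_filter => /andP[ts _].
    apply/negP => /flatten_mapP[t' _ /mapP[s' hs [es et]]].
    move: hs; rewrite mem_filter -es -et => /andP[st _].
    by have := ltn_trans st ts; rewrite ltnn.
  + apply: (@allpairs_uniq_dep _ (fun=> 'I_n) _ (fun s t => (s, t))).
    * exact: enum_uniq.
    * by move=> t _; apply/filter_uniq/enum_uniq.
    * by move=> [a b] [c d] /= _ _ [-> ->].
- exact: enum_uniq.
Qed.

Lemma size_ve_pos : size ve_pos = (2 * NN n)%N.
Proof.
rewrite (perm_size perm_ve_pos) -cardE.
have -> : #|[pred p : pair_t n | p.1 != p.2]| = (n * n.-1)%N.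
  rewrite -sum1_card -(pair_big_dep predT (fun k l : 'I_n => k != l) (fun _ _ => 1%N)) /=.
  rewrite (eq_bigr (fun=> n.-1)) ?sum_nat_const ?card_ord // => k _.
  rewrite sum1_card -[in RHS](card_ord n) -(cardC1 k).
  by apply: eq_card => l; rewrite !inE eq_sym.
(* The integer division in [NN] is exact because n(n-1) is even. *)
rewrite /NN [RHS]mulnC divnK // dvdn2.
by case: n => // m; rewrite oddM /= andNb.
Qed.

Lemma ve_eq A B : (forall k l, k != l -> A k l = B k l) -> ve A = ve B.
Proof.
move=> AB; suff : ve_seq A = ve_seq B by rewrite /ve => ->.
rewrite !ve_seqE; apply/eq_in_map => p.
by rewrite (perm_mem perm_ve_pos) mem_enum => /AB.
Qed.

Lemma vnorm2_ve A : zdiag A -> vnorm2 (ve A) = energy A.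
Proof.
move=> zA; rewrite /vnorm2.
have szA : size (ve_seq A) = (2 * NN n)%N by rewrite ve_seqE size_map size_ve_pos.
transitivity (\sum_(x <- ve_seq A) sqc x).
  by rewrite (big_nth 0) szA big_mkord; apply: eq_bigr => k _; rewrite mxE.
rewrite ve_seqE big_map (perm_big _ perm_ve_pos) /= big_enum /=.
rewrite /energy [RHS](bigID (fun p : pair_t n => p.1 != p.2)) /=.
by rewrite [X in _ = _ + X]big1 ?addr0 // => p; rewrite negbK => /eqP ->; rewrite zA sqc0.
Qed.

(** Together with [vnorm2_ve], this reduces norm bounds on vectors to energy bounds on zero-diagonal
    matrices. *)
Lemma ve_surj (v : 'cV[R[i]]_(2 * NN n)) : exists2 A, zdiag A & ve A = v.
Proof.
pose sv := [seq v k 0 | k <- enum 'I_(2 * NN n)].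
exists (\matrix_(k, l) if k == l then 0 else nth 0 sv (index (k, l) ve_pos)).
  by move=> k; rewrite mxE eqxx.
apply/colP=> k; rewrite mxE ve_seqE.
have kp : (k < size ve_pos)%N by rewrite size_ve_pos.
(* The index [k] shows that [ve_pos] is nonempty, which supplies a default pair for [nth]. *)
have [p0 _] : exists p : pair_t n, True.
  by case: ve_pos kp => // p _ _; exists p.
rewrite (nth_map p0) // mxE -surjective_pairing.
have := mem_nth p0 kp; rewrite (perm_mem perm_ve_pos) mem_enum inE => /negbTE ->.
rewrite index_uniq ?(perm_uniq perm_ve_pos) ?enum_uniq //.
by rewrite (nth_map k) ?size_enum_ord // nth_ord_enum.
Qed.

(** Applied to the conjugated matrix, [nuij] and [block0] differ only at diagonal positions, which
    [ve] does not read. *)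
Lemma annihilator_step (x : letter R n) M A : proper x ->
  is_annihilator x.1.1 x.1.2 (rot x.1.1 x.1.2 x.2.1 x.2.2) M ->
  M *m ve A = ve (step x A).
Proof.
move=> px ->; apply: ve_eq => k l kl; rewrite stepE // [LHS]mxE [RHS]mxE /lrot.
case: (eqVneq k x.1.1) => k1; case: (eqVneq l x.1.1) => l1;
  case: (eqVneq k x.1.2) => k2; case: (eqVneq l x.1.2) => l2 //;
  by rewrite ?k1 ?k2 -?l1 -?l2 eqxx in kl.
Qed.

Lemma Jnu_run nu O J : (forall p, p \in O -> p.1 != p.2) -> in_Jnu nu O J ->
  exists2 w : seq (letter R n), map fst w = O /\ all (admissible nu) w &
    forall A, J *m ve A = ve (run A w).
Proof.
elim: O J => [|p O IH] J pO /=.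
  by move=> ->; exists [::] => // A; rewrite mul1mx.
move=> [Rk [M' [[phi [alpha [hc hR]]] [hM ->]]]].
have [|w [hw aw] wE] := IH M' _ hM.
  by move=> q qO; apply: pO; rewrite inE qO orbT.
have pp := pO p (mem_head _ _).
exists ((p, (phi, alpha)) :: w).
  by rewrite /= hw aw /admissible /proper /= pp hc.
move=> A; rewrite -mulmxA (@annihilator_step (p, (phi, alpha)) Rk A) //.
Qed.

Lemma Jnu_prod_run nu O (Js : seq 'M[R[i]]_(2 * NN n)) :
  (forall p, p \in O -> p.1 != p.2) -> (forall J, J \in Js -> in_Jnu nu O J) ->
  exists2 w : seq (letter R n), map fst w = opow (size Js) O /\ all (admissible nu) w &
    forall A, foldr (fun M N => M *m N) 1%:M Js *m ve A = ve (run A w).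
Proof.
move=> pO; elim: Js => [|J Js IH] hJ.
  by exists [::] => // A; rewrite mul1mx.
have [|w1 [hw1 a1] w1E] := IH; first by move=> M MJ; apply: hJ; rewrite inE MJ orbT.
have [w2 [hw2 a2] w2E] := Jnu_run pO (hJ J (mem_head _ _)).
(* The head of [Js] is the leftmost factor and acts last, so its word comes second. *)
exists (w1 ++ w2); first by rewrite map_cat hw1 hw2 -opowSr all_cat a1 a2.
by move=> A; rewrite /= -mulmxA w1E w2E /run foldl_cat.
Qed.

End Vectorization.

(** * Spectral norm and conclusion *)

Lemma spec_norm_le (R : realType) m (M : 'M[R[i]]_m) (kappa : R) : 0 <= kappa ->
  (forall v, vnorm2 (M *m v) <= kappa * vnorm2 v) ->
  spec_norm M <= Num.sqrt kappa.
Proof.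
move=> k0 hM; rewrite /spec_norm; set E := [set _ | _ in _]%classic.
(* Without unit vectors, as in dimension 0, the supremum takes its default value 0. *)
have [->|/set0P E0] := eqVneq E set0%classic; first by rewrite sup0 sqrtr_ge0.
apply: ge_sup => // _ [v v1 <-]; apply: ler_wsqrtr.
by apply: (le_trans (hM v)); rewrite v1 mulr1.
Qed.

Theorem theorem3p6 (R : realType) (n : nat) (hn : (2 <= n)%N) (nu : R)
    (hnu0 : 0 < nu) (hnu1 : nu <= 1) :
  exists zeta : R, 0 <= zeta < 1 /\
    forall (O O' O'' : seq (pair_t n)) (d : nat),
      in_Csg O -> in_Csp O'' ->
      ((perm_equiv O O' /\ canon_weak_equiv d O' O'') \/
       (canon_weak_equiv d O O' /\ perm_equiv O' O'')) ->
      forall Js : seq 'M[R[i]]_(2 * NN n),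
        size Js = d.+1 -> (forall J, J \in Js -> in_Jnu nu O J) ->
        spec_norm (foldr (fun A B => A *m B) 1%:M Js) <= zeta.
Proof.
have [kappa /andP[k0 k1] hCc] := contracts_Cc n hnu0 hnu1.
have k0' := ltW k0.
(* The square root passes from energies to norms; [kappa] was fixed before the orderings and [d]. *)
exists (Num.sqrt kappa); split.
  by rewrite sqrtr_ge0 /= -sqrtr1 ltr_sqrt.
have hCr (O : seq (pair_t n)) : in_Cr O -> contracts nu kappa O.
  move=> /in_Cr_flip[O' [cO' [q qO]]]; apply: (@contracts_perm _ _ _ _ _ q).
  by have := hCc _ cO'; rewrite qO.
have hsp (O : seq (pair_t n)) : in_Csp O -> contracts nu kappa (opow 1 O).
  rewrite /opow /= cats0.
  by move=> [/hCc //|[/hCc /(contracts_rev k0) //|[/hCr //|/hCr /(contracts_rev k0)]]].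
move=> O O' O'' d [[_ ordO] _] /hsp c2 hO Js sJ hJ.
(* One serial sweep plus one more per shift makes [d.+1]; relabelling, on either side of the chain,
   leaves this count unchanged. *)
have cO : contracts nu kappa (opow d.+1 O).
  case: hO => [[pO [st [ch [_ <-]]]]|[[st [ch [_ <-]]] pO]].
    by apply: contracts_opow_perm pO _; apply: contracts_chain ch c2.
  by apply: (contracts_chain k0' ch (m := 1)); apply: contracts_opow_perm pO _.
have pO p : p \in O -> p.1 != p.2.
  by rewrite ordO => lt; rewrite -val_eqE neq_ltn lt.
have [w [hw aw] wE] := Jnu_prod_run pO hJ; rewrite sJ in hw.
apply: spec_norm_le => // v; have [A zA <-] := ve_surj v.
rewrite wE !vnorm2_ve //; first exact: cO.
by apply: zdiag_run => //; apply: admissible_proper aw.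
Qed.
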